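(* For every integer $d\ge 4$, $f(d)\ge 2^{\frac{d}{2}+1}$, where $f(d)$ denotes the maximum size of an acute set in $\mathbb{R}^d$.
   Context: A set $S$ of points in $\mathbb{R}^d$ (with the standard Euclidean inner product $\langle\cdot,\cdot\rangle$) is called acute if any three distinct points of $S$ form only acute angles, i.e. for all pairwise distinct $x,y,z\in S$ the angle at $x$ between $y-x$ and $z-x$ is strictly less than $\pi/2$, equivalently $\langle y-x,z-x\rangle>0$. (Sets with at most two points are vacuously acute.) For a positive integer $d$, $f(d)$ denotes the maximum cardinality of an acute set in $\mathbb{R}^d$; this maximum is known to be finite. It is known from earlier work (Harangi, 2011) that $f(4)\ge 8$ and $f(5)\ge 12$. *)

(* Defs.v *)
From mathcomp Require Import all_boot all_order all_algebra.
From mathcomp Require Import all_classical all_reals all_analysis.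
From mathcomp Require Import ring lra.

Set Implicit Arguments.
Unset Strict Implicit.
Unset Printing Implicit Defensive.

Import Order.TTheory GRing.Theory Num.Theory.
Local Open Scope classical_set_scope.
Local Open Scope card_scope.
Local Open Scope ring_scope.

(* The norm that the library puts on 'rV[R]_d is the sup norm, hence the
   explicit Euclidean norm [enorm]. *)
Definition inner (R : realType) (d : nat) (u v : 'rV[R]_d) : R :=
  \sum_(i < d) u 0 i * v 0 i.

Definition enorm (R : realType) (d : nat) (u : 'rV[R]_d) : R :=
  Num.sqrt (inner u u).

(* The angle at x between y - x and z - x, in [0, pi]; only meaningful when
   y and z are both different from x. *)
Definition angle (R : realType) (d : nat) (x y z : 'rV[R]_d) : R :=
  acos (inner (y - x) (z - x) / (enorm (y - x) * enorm (z - x))).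

Definition acute (R : realType) (d : nat) (S : set 'rV[R]_d) : Prop :=
  forall x y z, S x -> S y -> S z -> x <> y -> x <> z -> y <> z ->
    angle x y z < pi / 2.

(* S ranges over all acute sets, including a priori infinite ones; `I_m is the
   set of the m first natural numbers. *)
Definition is_max_acute_card (R : realType) (d m : nat) : Prop :=
  (exists S : set 'rV[R]_d, acute S /\ S #= `I_m) /\
  (forall S : set 'rV[R]_d, acute S -> S #<= `I_m).

(* The default value 0 of [xget] is never used, see [max_acute_cardP] below. *)
Definition max_acute_card (R : realType) (d : nat) : nat :=
  xget 0%N [set m | is_max_acute_card R d m].

Section Facts.
Context {R : realType} {d : nat}.
Implicit Types (u v x y z : 'rV[R]_d) (S : set 'rV[R]_d).

Lemma inner_ge0 u : 0 <= inner u u.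
Proof. by apply: sumr_ge0 => i _; rewrite -expr2 sqr_ge0. Qed.

Lemma enorm_gt0 u : u <> 0 -> 0 < enorm u.
Proof.
move=> u0; rewrite sqrtr_gt0 lt_neqAle inner_ge0 andbT eq_sym.
apply/eqP => /eqP; rewrite psumr_eq0; last first.
  by move=> i _; rewrite -expr2 sqr_ge0.
move=> /allP h; apply: u0; apply/rowP => i; rewrite mxE.
by have := h i (mem_index_enum i); rewrite /= mulf_eq0 orbb => /eqP.
Qed.

Lemma inner_enorm u v : `|inner u v| <= enorm u * enorm v.
Proof.
have [->|/eqP u0] := eqVneq u 0.
  rewrite [inner 0 v]big1 ?normr0 ?mulr_ge0 ?sqrtr_ge0// => i _.
  by rewrite mxE mul0r.
have [->|/eqP v0] := eqVneq v 0.
  rewrite [inner u 0]big1 ?normr0 ?mulr_ge0 ?sqrtr_ge0// => i _.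
  by rewrite mxE mulr0.
have key (s : R) : s ^+ 2 = 1 -> s * inner u v <= enorm u * enorm v.
  move=> s1; set a := enorm u; set b := enorm v.
  have ab0 : 0 < a * b by rewrite mulr_gt0 ?enorm_gt0.
  have : 0 <= inner (b *: u - (s * a) *: v) (b *: u - (s * a) *: v).
    exact: inner_ge0.
  have -> : inner (b *: u - (s * a) *: v) (b *: u - (s * a) *: v) =
     b ^+ 2 * inner u u - (s * inner u v) * (a * b) *+ 2
       + (s ^+ 2 * a ^+ 2) * inner v v.
    rewrite /inner mulr_sumr mulr_sumr mulr_suml -sumrMnl -sumrB.
    rewrite mulr_sumr -big_split /=; apply: eq_bigr => i _; rewrite !mxE.
    by rewrite mulr2n; ring.
  have -> : inner u u = a ^+ 2 by rewrite sqr_sqrtr ?inner_ge0.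
  have -> : inner v v = b ^+ 2 by rewrite sqr_sqrtr ?inner_ge0.
  rewrite s1 (_ : _ + _ = a * b * ((a * b - s * inner u v) * 2)); last by ring.
  by rewrite pmulr_rge0// pmulr_lge0// subr_ge0.
rewrite ler_norml; apply/andP; split; last by rewrite -[leLHS]mul1r key ?expr1n.
by rewrite lerNl -mulN1r key ?sqrrN ?expr1n.
Qed.

Lemma angle_lt_pihalf x y z : x <> y -> x <> z ->
  (angle x y z < pi / 2) = (0 < inner (y - x) (z - x)).
Proof.
move=> xy xz; rewrite /angle.
set a := inner _ _; set n := enorm _ * enorm _.
have n0 : 0 < n.
  by rewrite mulr_gt0// enorm_gt0// => /eqP; rewrite subr_eq0 => /eqP/esym.
have an : `|a| <= n by exact: inner_enorm.
have /andP[h1 h2] : -1 <= a / n <= 1.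
  by rewrite -ler_norml normrM normfV (gtr0_norm n0) ler_pdivrMr ?mul1r.
have K : cos (acos (a / n)) = a / n by rewrite acosK// in_itv /= h1.
have c0 : 0 <= acos (a / n) by rewrite acos_ge0// h1.
have cpi : acos (a / n) <= pi by rewrite acos_lepi// h1.
have -> : (0 < a) = (0 < a / n) by rewrite pmulr_lgt0 ?invr_gt0.
rewrite -[in RHS]K -[in RHS]cos_pihalf.
have p0 := pi_gt0 R.
rewrite ltr_cos ?in_itv //= ?c0 ?cpi//.
by apply/andP; split; lra.
Qed.

Let orth x y : {ffun 'I_d -> bool} := [ffun i => x 0 i <= y 0 i].

Let orth_inner x y z : orth x y = orth y z -> inner (x - y) (z - y) <= 0.
Proof.
move=> /ffunP e; apply: sumr_le0 => i _; have := e i; rewrite !ffunE !mxE.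
have [xy /esym yz|yx /esym/negbT] := leP (x 0 i) (y 0 i).
  by rewrite mulr_le0_ge0 ?subr_le0 ?subr_ge0.
by rewrite -ltNge => zy; rewrite mulr_ge0_le0 ?subr_le0 ?subr_ge0 ?ltW.
Qed.

Lemma acute_bounded : exists N, forall S, acute S -> S #<= `I_N.
Proof.
exists #|{set {ffun 'I_d -> bool}}| => S aS.
pose C x : {set {ffun 'I_d -> bool}} :=
  finset (fun c => `[< exists w, [/\ S w, w <> x & orth w x = c] >]).
have CI : {in S &, injective C}.
  move=> x y /set_mem Sx /set_mem Sy Cxy; apply: contrapT => xy.
  have : orth x y \in C y by rewrite inE; apply/asboolP; exists x.
  rewrite -Cxy inE => /asboolP[w [Sw wx e]].
  have wy : w <> y.
    move=> wy; apply: xy; apply/rowP => i; move/ffunP/(_ i): e.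
    rewrite wy !ffunE.
    have [yx /esym xy|xy /esym/negbT] := leP (y 0 i) (x 0 i).
      by apply/le_anti; rewrite yx xy.
    by rewrite -ltNge => /(lt_trans xy); rewrite ltxx.
  have := aS x w y Sx Sw Sy (nesym wx) xy wy.
  by rewrite angle_lt_pihalf ?ltNge ?orth_inner//; exact: nesym.
pose r x : nat := enum_rank (C x).
have E : r @` S #= S.
  by apply: inj_card_eq => x y Sx Sy /val_inj/enum_rank_inj; exact: CI.
rewrite -(card_le_eql E) subset_card_le// => _ [x _ <-] /=.
exact: ltn_ord.
Qed.

Lemma max_acute_cardP : is_max_acute_card R d (max_acute_card R d).
Proof.
rewrite /max_acute_card; apply: xgetPex => /=.
have [N bN] := acute_bounded.
pose P m := `[< exists S, acute S /\ S #= `I_m >].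
have exP : exists m, P m.
  exists 0%N; apply/asboolP; exists set0; split; first by move=> x.
  by rewrite II0.
have PN m : P m -> (m <= N)%N.
  by move=> /asboolP[S [/bN SN Sm]]; rewrite -card_le_II -(card_le_eql Sm).
case: (ex_maxnP exP PN) => m /asboolP mP mmax; exists m; split=> // S aS.
have /finite_setP[k Sk] : finite_set S.
  by apply: card_le_finite (bN _ aS) _.
by rewrite (card_le_eql Sk) card_le_II mmax//; apply/asboolP; exists S.
Qed.

End Facts.

(* Main.v *)
(** If [x] ranges over an acute set in dimension d, rescaled so that all its
    inner products exceed 2, and the [phi x] are pairwise non-parallel unit
    vectors of the plane, then the points [(x, phi x)] and [(x, - phi x)] form
    an acute set in dimension d + 2: angles over three distinct [x] survive the
    bounded perturbation, and the remaining ones are governed by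
    [|<phi x, phi y>| < 1].  Starting from 8 points in dimension 4 and 12 points
    in dimension 5, doubling gives the bound, since [8 * sqrt 2 <= 12]. *)
Require Import Defs.
From mathcomp Require Import all_boot all_order all_algebra.
From mathcomp Require Import all_classical all_reals all_analysis.
From mathcomp Require Import zify ring lra.

Set Implicit Arguments.
Unset Strict Implicit.
Unset Printing Implicit Defensive.

Import Order.TTheory GRing.Theory Num.Theory.
Local Open Scope ring_scope.

Section InnerProduct.
Context {R : realType}.

Lemma innerC d (u v : 'rV[R]_d) : inner u v = inner v u.
Proof. by apply: eq_bigr => i _; rewrite mulrC. Qed.

Lemma innerBl d (u v w : 'rV[R]_d) : inner (u - v) w = inner u w - inner v w.
Proof. by rewrite -sumrB; apply: eq_bigr => i _; rewrite !mxE mulrBl. Qed.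

Lemma innerBr d (u v w : 'rV[R]_d) : inner u (v - w) = inner u v - inner u w.
Proof. by rewrite innerC innerBl !(innerC u). Qed.

Lemma innerZl d (a : R) (u v : 'rV[R]_d) : inner (a *: u) v = a * inner u v.
Proof. by rewrite /inner mulr_sumr; apply: eq_bigr => i _; rewrite mxE mulrA. Qed.

Lemma innerZr d (a : R) (u v : 'rV[R]_d) : inner u (a *: v) = a * inner u v.
Proof. by rewrite innerC innerZl innerC. Qed.

Lemma inner_row_mx m n (u u' : 'rV[R]_m) (v v' : 'rV[R]_n) :
  inner (row_mx u v) (row_mx u' v') = inner u u' + inner v v'.
Proof.
rewrite /inner big_split_ord /=.
by congr (_ + _); apply: eq_bigr => i _; rewrite ?row_mxEl ?row_mxEr.
Qed.

End InnerProduct.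

(* The case [j = k] makes an acute family injective. *)
Definition acute_family (R : realType) (I : finType) (d : nat)
    (p : I -> 'rV[R]_d) : Prop :=
  forall i j k, j != i -> k != i -> 0 < inner (p j - p i) (p k - p i).

(** The index type is arbitrary so that doubling can pass directly to [I * bool]. *)
Definition acute_size (R : realType) (d n : nat) : Prop :=
  exists (I : finType) (p : I -> 'rV[R]_d), acute_family p /\ #|I| = n.

Lemma acute_size_le_max (R : realType) d n :
  acute_size R d n -> (n <= max_acute_card R d)%N.
Proof.
move=> [I [p [pP <-]]].
have p_inj : injective p.
  move=> i j pij; apply/eqP; apply: contraT => ij.
  by have := pP j i i ij ij; rewrite innerBl pij subrr ltxx.
pose f : 'I_#|I| -> 'rV[R]_d := p \o enum_val.
pose S : set 'rV[R]_d := range f.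
have aS : acute S.
  move=> _ _ _ [i _ <-] [j _ <-] [k _ <-] ij ik _.
  rewrite angle_lt_pihalf //; apply: pP; apply/eqP => e.
    by apply: ij; rewrite /f /= e.
  by apply: ik; rewrite /f /= e.
have IS : (`I_#|I| #= S)%card.
  apply: (card_eq_trans card_II); rewrite card_eq_sym; apply: inj_card_eq.
  by move=> x y _ _ /p_inj/enum_val_inj.
have [_ /(_ S aS)] := @max_acute_cardP R d.
by rewrite -(card_le_eql IS) card_le_II.
Qed.

Section Doubling.
Context {R : realType}.

(* Rational parametrization of the unit circle; the angle of [circle_point t]
   stays in [0, pi[ for [t >= 0], hence no two of these points are parallel. *)
Definition circle_point (t : R) : 'rV[R]_2 :=
  \row_j (if j == 0 then (1 - t ^+ 2) / (1 + t ^+ 2)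
          else 2 * t / (1 + t ^+ 2)).

Lemma inner_circle_point s t : inner (circle_point s) (circle_point t) =
  ((1 - s ^+ 2) * (1 - t ^+ 2) + 4 * s * t) / ((1 + s ^+ 2) * (1 + t ^+ 2)).
Proof.
rewrite /inner !big_ord_recl big_ord0 !mxE /=; field.
by rewrite !lt0r_neq0 // ltr_pwDl ?sqr_ge0.
Qed.

Lemma inner_circle_pointxx t : inner (circle_point t) (circle_point t) = 1.
Proof.
rewrite inner_circle_point; field.
by rewrite lt0r_neq0 // ltr_pwDl ?sqr_ge0.
Qed.

Lemma inner_circle_point_lt1 s t : 0 <= s -> 0 <= t -> s != t ->
  `|inner (circle_point s) (circle_point t)| < 1.
Proof.
move=> s0 t0 st; rewrite inner_circle_point.
have s2 : 0 < 1 + s ^+ 2 by rewrite ltr_pwDl ?sqr_ge0.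
have t2 : 0 < 1 + t ^+ 2 by rewrite ltr_pwDl ?sqr_ge0.
have D0 : 0 < (1 + s ^+ 2) * (1 + t ^+ 2) by rewrite mulr_gt0.
rewrite normrM normfV (gtr0_norm D0) ltr_pdivrMr // mul1r ltr_norml.
(* For numerator N and denominator D, D - N = 2 (s - t)^2 and D + N = 2 (1 + s t)^2, both
   positive. *)
have d0 : 0 < (s - t) ^+ 2.
  by rewrite lt_neqAle sqr_ge0 andbT eq_sym sqrf_eq0 subr_eq0.
have st0 : 0 <= s * t by rewrite mulr_ge0.
by apply/andP; split; nra.
Qed.

(** Finitely many triples allow one common factor; 2 is chosen because the plane coordinates added
    by doubling lower an inner product by at most 2. *)
Lemma exists_acute_scaling (I : finType) d (p : I -> 'rV[R]_d) :
  acute_family p -> exists c : R, forall i j k, j != i -> k != i ->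
    2 < c ^+ 2 * inner (p j - p i) (p k - p i).
Proof.
move=> pP.
pose q (x : I * I * I) := inner (p x.1.2 - p x.1.1) (p x.2 - p x.1.1).
(* For each positive value r of [q], the sum dominates 2 / r, and c >= 1 gives c^2 r >= c r >= r +
   2. The absolute values keep the other summands nonnegative. *)
pose c := 1 + \sum_x 2 * `|q x|^-1.
exists c => i j k ji ki; have qp := pP i j k ji ki.
set r := inner _ _ in qp *.
have rc : 1 + 2 / r <= c.
  rewrite lerD2l (bigD1 (i, j, k)) //= /q /= -/r gtr0_norm // lerDl.
  by apply: sumr_ge0 => x _; rewrite mulr_ge0 // invr_ge0.
have r0 : 0 < 2 / r by rewrite divr_gt0.
have c1 : c <= c ^+ 2 by rewrite expr2 ler_peMr //; lra.
have : (1 + 2 / r) * r <= c ^+ 2 * r by rewrite ler_pM2r //; lra.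
by rewrite mulrDl mul1r divfK ?lt0r_neq0 //; lra.
Qed.

Lemma acute_size_double d n :
  acute_size R d n -> acute_size R (d + 2) (n * 2).
Proof.
move=> [I [p [pP cI]]]; have [c cP] := exists_acute_scaling pP.
(* Ranks serve as distinct nonnegative parameters, so these vectors are pairwise non-parallel. *)
pose phi (i : I) := circle_point (enum_rank i : nat)%:R.
pose s (b : bool) : R := if b then 1 else -1.
pose q (x : I * bool) := row_mx (c *: p x.1) (s x.2 *: phi x.1).
exists (I * bool)%type, q; split; last by rewrite card_prod card_bool cI.
have qE i a j b k e : inner (q (j, b) - q (i, a)) (q (k, e) - q (i, a)) =
    c ^+ 2 * inner (p j - p i) (p k - p i)
    + inner (s b *: phi j - s a *: phi i) (s e *: phi k - s a *: phi i).
  rewrite !opp_row_mx !add_row_mx inner_row_mx -!scalerBr innerZl innerZr.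
  by rewrite mulrA -expr2.
have phi1 i : inner (phi i) (phi i) = 1 by exact: inner_circle_pointxx.
have phi_lt1 i j : i != j -> `|inner (phi i) (phi j)| < 1.
  move=> ij; apply: inner_circle_point_lt1; rewrite ?ler0n // eqr_nat.
  by apply: contra_neq ij => /val_inj/enum_rank_inj.
have phi_le1 i j : `|inner (phi i) (phi j)| <= 1.
  by have [->|/phi_lt1/ltW//] := eqVneq i j; rewrite phi1 normr1.
have s_sgn b : s b = 1 \/ s b = -1 by case: b; [left|right].
(* Here b is the negation of a, so the first block vanishes and the plane block is 2 - 2 (s a) (s e)
   <phi i, phi k>: this is 4 if k = i, as then e = b, and positive otherwise. *)
have twin_angle i a b k e : (i, b) != (i, a) -> (k, e) != (i, a) ->
    0 < inner (q (i, b) - q (i, a)) (q (k, e) - q (i, a)).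
  rewrite !xpair_eqE eqxx /= => ba ka.
  rewrite qE innerBl subrr mulr0 add0r !(innerBl, innerBr, innerZl, innerZr) phi1.
  have [ki|ki] := eqVneq k i.
    move: ka; rewrite ki eqxx phi1 /=.
    by case: a ba; case: b; case: e => //= _ _; rewrite /s; lra.
  have := phi_lt1 i k; rewrite eq_sym ki => /(_ isT)/ltr_normlP[].
  by case: a ba {ka}; case: b; case: e => //= _; rewrite /s; lra.
move=> [i a] [j b] [k e] ja ka.
have [ji|ji] := eqVneq j i; first by subst j; exact: twin_angle.
have [ki|ki] := eqVneq k i; first by subst k; rewrite innerC; exact: twin_angle.
(* The plane block is <phi i, phi i> = 1 plus three terms of absolute value at most 1, hence at
   least -2. *)
rewrite qE; have := cP i j k ji ki.
have /ler_normlP[] := phi_le1 j k; have /ler_normlP[] := phi_le1 j i.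
have /ler_normlP[] := phi_le1 i k.
rewrite !(innerBl, innerBr, innerZl, innerZr) phi1.
by case: (s_sgn a) => ->; case: (s_sgn b) => ->; case: (s_sgn e) => ->; lra.
Qed.

Lemma acute_size_iter_double d n m :
  acute_size R d n -> acute_size R (d + m * 2) (n * 2 ^ m).
Proof.
move=> dn; elim: m => [|m IHm]; first by rewrite addn0 muln1.
by rewrite mulSn (addnC 2%N) addnA expnSr mulnA; exact: acute_size_double.
Qed.

End Doubling.

(** Integer lists let acuteness of explicit configurations be decided by computation. *)
Definition dotz (d : nat) (u v : seq int) : int :=
  foldr +%R 0 [seq u`_i * v`_i | i <- iota 0 d].

Definition subz (d : nat) (u v : seq int) : seq int :=
  [seq u`_i - v`_i | i <- iota 0 d].

Definition acutez (d : nat) (P : seq (seq int)) : bool :=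
  let n := size P in
  all (fun i => all (fun j => all (fun k =>
    [|| j == i, k == i
      | 0 < dotz d (subz d (nth [::] P j) (nth [::] P i))
                   (subz d (nth [::] P k) (nth [::] P i))])
    (iota 0 n)) (iota 0 n)) (iota 0 n).

Lemma inner_intr (R : realType) d (u v : seq int) :
  inner (\row_(i < d) (u`_i)%:~R : 'rV[R]_d) (\row_i (v`_i)%:~R)
    = (dotz d u v)%:~R.
Proof.
rewrite /dotz foldrE big_map -[X in iota 0 X](subn0 d) big_mkord rmorph_sum.
by apply: eq_bigr => i _; rewrite !mxE rmorphM.
Qed.

Lemma subz_intr (R : realType) d (u v : seq int) :
  \row_(i < d) (u`_i)%:~R - \row_i (v`_i)%:~R
    = \row_i ((subz d u v)`_i)%:~R :> 'rV[R]_d.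
Proof.
apply/rowP => i; rewrite !mxE -rmorphB; congr (_%:~R).
by rewrite (nth_map 0%N) ?size_iota // nth_iota.
Qed.

Lemma acute_size_acutez (R : realType) d P :
  acutez d P -> acute_size R d (size P).
Proof.
move=> /allP aP.
exists 'I_(size P), (fun i : 'I__ => \row_j ((nth [::] P i)`_j)%:~R).
split=> [i j k ji ki|]; last exact: card_ord.
have mem_iota_ord (l : 'I_(size P)) : (l : nat) \in iota 0 (size P).
  by rewrite mem_iota /=.
have /allP/(_ _ (mem_iota_ord j))/allP/(_ _ (mem_iota_ord k)) :=
  aP _ (mem_iota_ord i).
rewrite !(inj_eq val_inj) (negPf ji) (negPf ki) /= !subz_intr inner_intr.
by rewrite ltr0z.
Qed.

(* Found by numerical search among the configurations invariant under negation
   of the first two coordinates. *)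
Definition points4 : seq (seq int) :=
  [:: [:: 8; 0; 12; -16]; [:: 6; 5; 22; 17];
      [:: 7; 3; -13; 8]; [:: 6; -18; 6; 1];
      [:: -8; 0; 12; -16]; [:: -6; -5; 22; 17];
      [:: -7; -3; -13; 8]; [:: -6; 18; 6; 1]].

Definition points5 : seq (seq int) :=
  [:: [:: -21; 12; 7; -17; 8]; [:: 1; -15; -16; 6; -11];
      [:: -7; -12; 1; 15; 9]; [:: -13; -6; -11; -5; 23];
      [:: 10; 10; 21; -7; -2]; [:: 1; 15; -5; -26; -5];
      [:: 21; -12; 7; -17; 8]; [:: -1; 15; -16; 6; -11];
      [:: 7; 12; 1; 15; 9]; [:: 13; 6; -11; -5; 23];
      [:: -10; -10; 21; -7; -2]; [:: -1; -15; -5; -26; -5]].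

Lemma acute_size4 (R : realType) : acute_size R 4 8.
Proof. by apply: (@acute_size_acutez R 4 points4); vm_compute. Qed.

Lemma acute_size5 (R : realType) : acute_size R 5 12.
Proof. by apply: (@acute_size_acutez R 5 points5); vm_compute. Qed.

Theorem mainTheorem2 (R : realType) (d : nat) (hd : (4 <= d)%N) :
  2 `^ (d%:R / 2 + 1) <= (max_acute_card R d)%:R :> R.
Proof.
(* The number of doublings; the parity of d selects 4 or 5 as starting dimension. *)
pose m := (d - 4)./2.
have [dE|dE] : d = (4 + m * 2)%N \/ d = (5 + m * 2)%N.
  by have := odd_double_half (d - 4); rewrite -/m -muln2; case: odd; lia.
- have := acute_size_le_max (acute_size_iter_double m (acute_size4 R)).
  rewrite -dE -(ler_nat R); apply: le_trans.
  (* In even dimension 8 * 2^m equals the bound exactly. *)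
  have -> : d%:R / 2 + 1 = (m + 3)%:R :> R.
    by rewrite dE !natrD natrM; field.
  by rewrite powR_mulrn // -natrX ler_nat expnD mulnC.
- have := acute_size_le_max (acute_size_iter_double m (acute_size5 R)).
  rewrite -dE -(ler_nat R); apply: le_trans.
  have -> : d%:R / 2 + 1 = (m + 3)%:R + 2^-1 :> R.
    by rewrite dE !natrD natrM; field.
  rewrite powRD ?pnatr_eq0 ?implybT // powR_mulrn // powR12_sqrt //.
  (* 3 / 2 is the ratio 12 / 8 of the starting sizes, as needed for 2^(m + 3) sqrt 2 <= 12 * 2^m. *)
  have sqrt2 : Num.sqrt 2 <= 3 / 2 :> R.
    by rewrite -(ler_sqr (sqrtr_ge0 _)) ?nnegrE ?sqr_sqrtr //; lra.
  rewrite natrM natrX exprD.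
  have : 0 <= 2 ^+ m :> R by rewrite exprn_ge0.
  by nra.
Qed.
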